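(* Let $f:\mathbb{R}^p\to\mathbb{R}$ be $L$-smooth and $m$-strongly convex with $m>0$, and let $x_\star$ be the unique point satisfying $\nabla f(x_\star)=0$. Consider Nesterov's accelerated method with parameters $\alpha,\beta\in\mathbb{R}$, $$x_{k+1}=y_k-\alpha\nabla f(y_k),\qquad y_k=(1+\beta)x_k-\beta x_{k-1},\qquad k=0,1,2,\dots$$ (with arbitrary $x_0,x_{-1}\in\mathbb{R}^p$). For any rate $0\le\rho<1$, set $\tilde X:=\rho^2\tilde X_1+(1-\rho^2)\tilde X_2$, where $$\tilde X_1:=\frac12\begin{bmatrix}\beta^2 m&-\beta^2 m&-\beta\\ -\beta^2 m&\beta^2 m&\beta\\ -\beta&\beta&\alpha(2-L\alpha)\end{bmatrix},\qquad \tilde X_2:=\frac12\begin{bmatrix}(1+\beta)^2m&-\beta(1+\beta)m&-(1+\beta)\\ -\beta(1+\beta)m&\beta^2m&\beta\\ -(1+\beta)&\beta&\alpha(2-L\alpha)\end{bmatrix},$$ and let $$\tilde A:=\begin{bmatrix}1+\beta&-\beta\\ 1&0\end{bmatrix},\qquad \tilde B:=\begin{bmatrix}-\alpha\\ 0\end{bmatrix}.$$ If there exists a matrix $\tilde P\in\mathbb{R}^{2\times2}$ with $\tilde P\ge0$ such that $$\begin{bmatrix}\tilde A^{\top}\tilde P\tilde A-\rho^2\tilde P&\tilde A^{\top}\tilde P\tilde B\\ \tilde B^{\top}\tilde P\tilde A&\tilde B^{\top}\tilde P\tilde B\end{bmatrix}-\tilde X\le0,$$ then, setting $P:=\tilde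 P\otimes I_p$, the function $$\mathcal V_k:=\begin{bmatrix}x_k-x_\star\\ x_{k-1}-x_\star\end{bmatrix}^{\top}P\begin{bmatrix}x_k-x_\star\\ x_{k-1}-x_\star\end{bmatrix}+f(x_k)-f(x_\star)$$ satisfies $\mathcal V_{k+1}\le\rho^2\mathcal V_k$ for all $k$. Moreover, $f(x_k)-f(x_\star)\le\rho^{2k}\mathcal V_0$ for all $k$.
   Context: Matrix inequalities $\ge 0$, $\le 0$ are between symmetric matrices in the semidefinite sense. $I_p$ is the $p\times p$ identity and $\otimes$ is the Kronecker product. A differentiable function $f:\mathbb{R}^p\to\mathbb{R}$ is $m$-strongly convex if $f(x)\ge f(y)+\nabla f(y)^{\top}(x-y)+\frac m2\|x-y\|^2$ for all $x,y\in\mathbb{R}^p$, and $L$-smooth if $\|\nabla f(x)-\nabla f(y)\|\le L\|x-y\|$ for all $x,y\in\mathbb{R}^p$. *)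

(* Defs.v *)
From mathcomp Require Export all_boot all_order all_algebra.
From mathcomp Require Export all_classical all_reals all_analysis.
From mathcomp Require Export mxtens.

Set Implicit Arguments.
Unset Strict Implicit.
Unset Printing Implicit Defensive.

Export Order.TTheory GRing.Theory Num.Theory.
Export numFieldNormedType.Exports.

Local Open Scope ring_scope.

Definition dotcv (R : realType) (p : nat) (u v : 'cV[R]_p) : R :=
  (u^T *m v) 0 0.

(* The Euclidean norm: the library's `|u| on matrices is the sup norm. The
   differentials below do not depend on this choice, the constants L and m do. *)
Definition enorm (R : realType) (p : nat) (u : 'cV[R]_p) : R :=
  Num.sqrt (dotcv u u).

Definition grad (R : realType) (p : nat) (f : 'cV[R]_p -> R) (x : 'cV[R]_p) :
    'cV[R]_p :=
  \col_i 'D_(delta_mx i 0) f x.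

Definition strongly_convex (R : realType) (p : nat) (m : R)
    (f : 'cV[R]_p -> R) : Prop :=
  (forall x, differentiable f x) /\
  (forall x y, f y + dotcv (grad f y) (x - y) + m / 2 * enorm (x - y) ^+ 2
               <= f x).

Definition smooth (R : realType) (p : nat) (L : R) (f : 'cV[R]_p -> R) : Prop :=
  (forall x, differentiable f x) /\
  (forall x y, enorm (grad f x - grad f y) <= L * enorm (x - y)).

Definition qform (R : realType) (n : nat) (A : 'M[R]_n) (v : 'cV[R]_n) : R :=
  (v^T *m A *m v) 0 0.

Definition psdmx (R : realType) (n : nat) (A : 'M[R]_n) : Prop :=
  A \is symmetricmx /\ (forall v, 0 <= qform A v).

Definition nsdmx (R : realType) (n : nat) (A : 'M[R]_n) : Prop :=
  A \is symmetricmx /\ (forall v, qform A v <= 0).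

Definition mx_of_rows (R : realType) (m n : nat) (s : seq (seq R)) :
    'M[R]_(m, n) :=
  \matrix_(i < m, j < n) nth 0 (nth [::] s i) j.

Definition Xtilde1 (R : realType) (alpha beta m L : R) : 'M[R]_(2 + 1) :=
  2^-1 *: mx_of_rows (2 + 1) (2 + 1)
    [:: [:: beta ^+ 2 * m    ; - (beta ^+ 2 * m) ; - beta                    ];
        [:: - (beta ^+ 2 * m); beta ^+ 2 * m     ; beta                      ];
        [:: - beta           ; beta              ; alpha * (2 - L * alpha)] ].

Definition Xtilde2 (R : realType) (alpha beta m L : R) : 'M[R]_(2 + 1) :=
  2^-1 *: mx_of_rows (2 + 1) (2 + 1)
    [:: [:: (1 + beta) ^+ 2 * m        ; - (beta * (1 + beta) * m); - (1 + beta)];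
        [:: - (beta * (1 + beta) * m)  ; beta ^+ 2 * m            ; beta        ];
        [:: - (1 + beta)               ; beta                     ;
                                                  alpha * (2 - L * alpha)] ].

Definition Xtilde (R : realType) (alpha beta m L rho : R) : 'M[R]_(2 + 1) :=
  rho ^+ 2 *: Xtilde1 alpha beta m L
  + (1 - rho ^+ 2) *: Xtilde2 alpha beta m L.

Definition Atilde (R : realType) (beta : R) : 'M[R]_2 :=
  mx_of_rows 2 2 [:: [:: 1 + beta; - beta]; [:: 1; 0] ].

Definition Btilde (R : realType) (alpha : R) : 'cV[R]_2 :=
  mx_of_rows 2 1 [:: [:: - alpha]; [:: 0] ].

Definition lmi_mx (R : realType) (rho : R) (A : 'M[R]_2) (B : 'cV[R]_2)
    (P : 'M[R]_2) : 'M[R]_(2 + 1) :=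
  block_mx (A^T *m P *m A - rho ^+ 2 *: P) (A^T *m P *m B)
           (B^T *m P *m A)                 (B^T *m P *m B).

(* Only the values x_k with k >= -1 are constrained. *)
Definition nesterov (R : realType) (p : nat) (f : 'cV[R]_p -> R)
    (alpha beta : R) (x : int -> 'cV[R]_p) (y : nat -> 'cV[R]_p) : Prop :=
  forall k : nat,
    y k = (1 + beta) *: x k%:Z - beta *: x (k%:Z - 1) /\
    x (k%:Z + 1) = y k - alpha *: grad f (y k).

Lemma addnn_mul2n (p : nat) : (p + p = 2 * p)%N.
Proof. by rewrite addnn mul2n. Qed.

(* The cast is needed because Ptilde *t 1%:M has size 2 * p while col_mx
   produces size p + p, which is not convertible to it. *)
Definition stack (R : realType) (p : nat) (u v : 'cV[R]_p) : 'cV[R]_(2 * p) :=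
  castmx (addnn_mul2n p, erefl) (col_mx u v).

Definition lyapunov (R : realType) (p : nat) (f : 'cV[R]_p -> R)
    (P : 'M[R]_(2 * p)) (xstar : 'cV[R]_p) (x : int -> 'cV[R]_p) (k : nat) : R :=
  qform P (stack (x k%:Z - xstar) (x (k%:Z - 1) - xstar))
  + (f (x k%:Z) - f xstar).

(* Main.v *)
Require Import Defs.
From mathcomp Require Import ring lra.
Local Open Scope ring_scope.
Local Open Scope classical_set_scope.

Set Implicit Arguments.
Unset Strict Implicit.
Unset Printing Implicit Defensive.

(** One gradient step decreases [f] by an explicit amount, and that amount is a
    quadratic form. For every [z],

      f (y - alpha g) - f z
        <= - (m/2 |y - z|^2 - <g, y - z> + alpha (2 - L alpha) / 2 |g|^2),

    where [g] is the gradient at [y] ([gradient_step_decrease]): smoothness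
    bounds [f] after the step from above ([descent]), strong convexity bounds
    [f z] from below. Take [y = y_k]. For [z = x_k] the difference [y - z] is
    [beta (x_k - x_(k-1))] and the right-hand side is minus the form of
    [Xtilde1]; for [z = xstar] the difference is
    [(1 + beta) (x_k - xstar) - beta (x_(k-1) - xstar)] and the right-hand side
    is minus the form of [Xtilde2]. Since

      f x_(k+1) - f xstar - rho^2 (f x_k - f xstar)
        = rho^2 (f x_(k+1) - f x_k) + (1 - rho^2) (f x_(k+1) - f xstar),

    the function values contribute at most minus the form of [Xtilde] to the
    change of the Lyapunov function, while the quadratic part contributes
    exactly the form of [lmi_mx], because [Atilde] and [Btilde] propagate the
    pair (x_k - xstar, x_(k-1) - xstar). The matrix inequality says that the
    sum of the two contributions is nonpositive.

    A form tensored with the identity is the sum of the 2-dimensional form over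
    the [p] coordinates ([qform_tens1]), so the 3-dimensional matrix inequality
    is applied once in each coordinate ([lmi_stack]), which gives
    [lyapunov_step]. The second claim follows by induction, as positivity of
    [Pt] makes the Lyapunov function an upper bound of [f x_k - f xstar]. *)

(** * Euclidean inner product *)

Lemma dotcvE (R : realType) (p : nat) (u v : 'cV[R]_p) :
  dotcv u v = \sum_i u i 0 * v i 0.
Proof. by rewrite /dotcv mxE; apply: eq_bigr => i _; rewrite mxE. Qed.

Lemma dotcvC (R : realType) (p : nat) (u v : 'cV[R]_p) : dotcv u v = dotcv v u.
Proof. by rewrite !dotcvE; apply: eq_bigr => i _; rewrite mulrC. Qed.

Lemma dotcvBl (R : realType) (p : nat) (u v w : 'cV[R]_p) :
  dotcv (u - v) w = dotcv u w - dotcv v w.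
Proof. by rewrite /dotcv linearB mulmxBl !mxE. Qed.

Lemma dotcvZl (R : realType) (p : nat) (a : R) (u v : 'cV[R]_p) :
  dotcv (a *: u) v = a * dotcv u v.
Proof. by rewrite /dotcv linearZ -scalemxAl mxE. Qed.

Lemma dotcvBr (R : realType) (p : nat) (u v w : 'cV[R]_p) :
  dotcv u (v - w) = dotcv u v - dotcv u w.
Proof. by rewrite !(dotcvC u) dotcvBl. Qed.

Lemma dotcvZr (R : realType) (p : nat) (a : R) (u v : 'cV[R]_p) :
  dotcv u (a *: v) = a * dotcv u v.
Proof. by rewrite !(dotcvC u) dotcvZl. Qed.

Lemma dotcvNr (R : realType) (p : nat) (u v : 'cV[R]_p) :
  dotcv u (- v) = - dotcv u v.
Proof. by rewrite -scaleN1r dotcvZr mulN1r. Qed.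

Lemma dotcv_ge0 (R : realType) (p : nat) (u : 'cV[R]_p) : 0 <= dotcv u u.
Proof. by rewrite dotcvE sumr_ge0 // => i _; rewrite -expr2 sqr_ge0. Qed.

Lemma enorm_sqr (R : realType) (p : nat) (u : 'cV[R]_p) :
  enorm u ^+ 2 = dotcv u u.
Proof. by rewrite sqr_sqrtr ?dotcv_ge0. Qed.

Lemma enormZ (R : realType) (p : nat) (a : R) (u : 'cV[R]_p) :
  enorm (a *: u) = `|a| * enorm u.
Proof.
by rewrite /enorm dotcvZl dotcvZr mulrA -expr2 sqrtrM ?sqr_ge0 // sqrtr_sqr.
Qed.

Lemma enormN (R : realType) (p : nat) (u : 'cV[R]_p) : enorm (- u) = enorm u.
Proof. by rewrite -scaleN1r enormZ normrN1 mul1r. Qed.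

Lemma enorm_ge0 (R : realType) (p : nat) (u : 'cV[R]_p) : 0 <= enorm u.
Proof. exact: sqrtr_ge0. Qed.

Lemma enorm_eq0 (R : realType) (p : nat) (u : 'cV[R]_p) :
  enorm u = 0 -> u = 0.
Proof.
move=> u0; have /eqP := enorm_sqr u.
rewrite u0 expr0n eq_sym dotcvE psumr_eq0 => [/allP uu0|i _].
  apply/matrixP => i j; rewrite (ord1 j) mxE.
  have := uu0 i (mem_index_enum _).
  by rewrite mulf_eq0 orbb => /eqP.
by rewrite -expr2 sqr_ge0.
Qed.

(** Cauchy-Schwarz: when both norms are nonzero, it is the nonnegativity of the
    squared length of [enorm v *: u - enorm u *: v]. *)
Lemma dotcv_le_enorm (R : realType) (p : nat) (u v : 'cV[R]_p) :
  dotcv u v <= enorm u * enorm v.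
Proof.
have D_ge0 := dotcv_ge0 (enorm v *: u - enorm u *: v).
have dot0r (w : 'cV[R]_p) : dotcv w 0 = 0 by rewrite /dotcv mulmx0 mxE.
have := enorm_ge0 u; rewrite le_eqVlt => /predU1P[u0|u_gt0].
  by rewrite -u0 mul0r (enorm_eq0 (esym u0)) dotcvC dot0r.
have := enorm_ge0 v; rewrite le_eqVlt => /predU1P[v0|v_gt0].
  by rewrite -v0 mulr0 (enorm_eq0 (esym v0)) dot0r.
rewrite -subr_ge0 -(pmulr_rge0 _ (mulr_gt0 u_gt0 v_gt0)).
move: D_ge0; rewrite !(dotcvBl, dotcvBr, dotcvZl, dotcvZr) (dotcvC v u).
rewrite -!enorm_sqr; nra.
Qed.

(** * Gradients and the descent lemma *)

Lemma derive_grad (R : realType) (p : nat) (f : 'cV[R]_p -> R)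
    (x h : 'cV[R]_p) :
  differentiable f x -> 'D_h f x = dotcv (grad f x) h.
Proof.
move=> df; rewrite dotcvE deriveE // [h in LHS]matrix_sum_delta linear_sum.
apply: eq_bigr => i _.
by rewrite big_ord1 linearZ mxE deriveE //= mulrC.
Qed.

Lemma is_derive_line (R : realType) (p : nat) (f : 'cV[R]_p -> R)
    (y d : 'cV[R]_p) (t : R) :
  differentiable f (y + t *: d) ->
  is_derive t 1 (fun s : R => f (y + s *: d)) (dotcv (grad f (y + t *: d)) d).
Proof.
move=> df; rewrite -derive_grad //.
have := derivableP (diff_derivable (v := d) df).
(* both derivatives are limits of the same difference quotient *)
have E : (fun h : R => h^-1 *: (f (h *: d + (y + t *: d)) - f (y + t *: d))) =
  (fun h : R => h^-1 *: (f (y + (h *: (1 : R) + t) *: d) - f (y + t *: d))).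
  by apply/funext => h; rewrite [h *: (1 : R)]mulr1 scalerDl addrCA.
by move=> [dv _]; split; rewrite /derivable /derive /= -E.
Qed.

(** Along the segment from [y] to [y + d], subtract from [f] the linear and
    quadratic terms of the upper model. By Cauchy-Schwarz the Lipschitz bound on
    the gradient makes the derivative of this difference [phi] nonpositive, so
    [phi 1 <= phi 0 = f y]. *)
Lemma descent (R : realType) (p : nat) (L : R) (f : 'cV[R]_p -> R)
    (y d : 'cV[R]_p) :
  smooth L f ->
  f (y + d) <= f y + dotcv (grad f y) d + L / 2 * enorm d ^+ 2.
Proof.
move=> [df fL].
pose phi (t : R) := f (y + t *: d) - t * dotcv (grad f y) d
                    - t ^+ 2 * (L / 2 * enorm d ^+ 2).
have phi' (t : R) : is_derive t 1 phi
    (dotcv (grad f (y + t *: d)) d - dotcv (grad f y) d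
     - t * (L * enorm d ^+ 2)).
  have fl := is_derive_line (df (y + t *: d)).
  rewrite /phi; apply: is_derive_eq.
  by rewrite /GRing.scale /=; field.
have phi'_le0 (t : R) : 0 <= t ->
    dotcv (grad f (y + t *: d)) d - dotcv (grad f y) d
    - t * (L * enorm d ^+ 2) <= 0.
  move=> t_ge0; rewrite -dotcvBl subr_le0.
  apply: le_trans (dotcv_le_enorm _ _) _.
  have := fL (y + t *: d) y.
  rewrite [X in X - y]addrC addrK enormZ ger0_norm // => gL.
  by have := ler_wpM2r (enorm_ge0 d) gL; congr (_ <= _); ring.
have : phi 1 <= phi 0.
  apply: (@ler0_derive1_nincr _ phi 0 1) => //.
  - move=> t; rewrite in_itv /= => /andP[/ltW t_ge0 _].
    by rewrite derive1E; have [_ ->] := phi' t; exact: phi'_le0.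
  - by apply: derivable_within_continuous => t _; case: (phi' t).
rewrite /phi scale1r scale0r addr0; lra.
Qed.

(** * Quadratic forms tensored with the identity *)

(** The identity factor only couples equal inner indices, so the form splits
    into one copy of [A] for each inner index [j], acting on the slice of [v]
    of the entries with that index. *)
Lemma qform_tens1 (R : realType) (n p : nat) (A : 'M[R]_n)
    (v : 'cV[R]_(n * p)) :
  qform (A *t 1%:M) v =
  \sum_(j < p) qform A (\col_i v (mxtens_index (i, j)) 0).
Proof.
have reindex (F : 'I_(n * p) -> R) :
    \sum_k F k = \sum_(i < n) \sum_(j < p) F (mxtens_index (i, j)).
  rewrite pair_big (reindex (@mxtens_index n p)) /=.
    by apply: eq_bigr => -[].
  by exists (@mxtens_unindex n p) => k _;
    rewrite (mxtens_indexK, mxtens_unindexK).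
rewrite /qform mxE reindex exchange_big /=; apply: eq_bigr => j _.
rewrite !mxE; apply: eq_bigr => i _; rewrite !mxE; congr (_ * _).
rewrite reindex; apply: eq_bigr => i' _.
rewrite (bigD1 j) //= !mxE !mxtens_indexK /= eqxx mulr1.
rewrite big1 ?addr0 // => j' j'j.
by rewrite !mxE !mxtens_indexK /= (negbTE j'j) mulr0 mulr0.
Qed.

Definition cv2 (R : realType) (a b : R) : 'cV[R]_2 :=
  mx_of_rows 2 1 [:: [:: a]; [:: b]].

Lemma qform_stack (R : realType) (p : nat) (A : 'M[R]_2) (u v : 'cV[R]_p) :
  qform (A *t 1%:M) (stack u v) = \sum_i qform A (cv2 (u i 0) (v i 0)).
Proof.
rewrite qform_tens1; apply: eq_bigr => j _; congr (qform A _).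
apply/matrixP => -[[|[|//]] lti] k;
  rewrite (ord1 k) [LHS]mxE castmxE [RHS]mxE /=.
  rewrite (_ : cast_ord _ _ = lshift p j) ?col_mxEu ?cast_ord_id //.
  by apply: val_inj; rewrite /= mul0n.
rewrite (_ : cast_ord _ _ = rshift p j) ?col_mxEd ?cast_ord_id //.
by apply: val_inj; rewrite /= mul1n.
Qed.

(** * The terms of the matrix inequality *)

Lemma qformB (R : realType) (n : nat) (A B : 'M[R]_n) (v : 'cV[R]_n) :
  qform (A - B) v = qform A v - qform B v.
Proof. by rewrite /qform mulmxBr mulmxBl !mxE. Qed.

(** [lmi_mx] is the change of the form [P] along the linear dynamics with state
    [w] and scalar input [g], the old value being discounted by [rho ^+ 2]. *)
Lemma qform_lmi_mx (R : realType) (rho : R) (A P : 'M[R]_2)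
    (B w : 'cV[R]_2) (g : R) :
  qform (lmi_mx rho A B P) (col_mx w g%:M) =
  qform P (A *m w + g *: B) - rho ^+ 2 * qform P w.
Proof.
rewrite /qform /lmi_mx tr_col_mx mul_row_block mul_row_col tr_scalar_mx.
rewrite !mul_scalar_mx !mul_mx_scalar.
rewrite [(_ + _)^T]linearD /= [(g *: B)^T]linearZ /= trmx_mul.
rewrite !(mulmxDl, mulmxDr, mulmxN, mulNmx) -!(scalemxAl, scalemxAr) !mulmxA.
rewrite !mxE; ring.
Qed.

(** One coordinate of the guaranteed decrease of [f] in a gradient step of
    length [a]: [d] is the displacement from the comparison point, [g] the
    gradient. *)
Definition step_cost (R : realType) (m L a d g : R) : R :=
  m / 2 * d ^+ 2 - d * g + a * (2 - L * a) / 2 * g ^+ 2.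

Lemma col_mx_cv2 (R : realType) (a b g : R) :
  col_mx (cv2 a b) g%:M = mx_of_rows (2 + 1) 1 [:: [:: a]; [:: b]; [:: g]].
Proof.
apply/matrixP => i j; rewrite (ord1 j).
case: (split_ordP i) => i' ->; rewrite (col_mxEu, col_mxEd).
  by case: i' => -[|[|//]] lti; rewrite !mxE.
by rewrite (ord1 i') !mxE.
Qed.

(** [Xtilde1] and [Xtilde2] have the same shape: each is the [step_cost] form
    composed with a linear functional of the state, namely the displacement of
    [y_k] from [x_k] for the first and from [xstar] for the second. *)
Lemma qform_Xtilde (R : realType) (alpha beta m L rho a b g : R) :
  qform (Xtilde alpha beta m L rho) (col_mx (cv2 a b) g%:M) =
  rho ^+ 2 * step_cost m L alpha (beta * (a - b)) g
  + (1 - rho ^+ 2) * step_cost m L alpha ((1 + beta) * a - beta * b) g.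
Proof.
(* indexing by 'I_3, convertible to 'I_(2 + 1), keeps big_ord_recl applicable *)
have qformE (A : 'M[R]_(2 + 1)) v :
    qform A v = \sum_(i < 3) \sum_(j < 3) v i 0 * A i j * v j 0.
  rewrite /qform mxE exchange_big; apply: eq_bigr => j _.
  by rewrite mxE mulr_suml; apply: eq_bigr => i _; rewrite mxE.
rewrite col_mx_cv2 qformE !big_ord_recl !big_ord0 !mxE /= /step_cost.
by field.
Qed.

(** * Decrease of the objective in a gradient step *)

Lemma sum_step_cost (R : realType) (p : nat) (m L a : R) (d g : 'cV[R]_p) :
  \sum_i step_cost m L a (d i 0) (g i 0) =
  m / 2 * enorm d ^+ 2 - dotcv g d + a * (2 - L * a) / 2 * enorm g ^+ 2.
Proof.
rewrite !enorm_sqr !dotcvE !mulr_sumr -sumrB -big_split /=.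
by apply: eq_bigr => i _; rewrite /step_cost; ring.
Qed.

(** The gradient step decreases [f] by the descent lemma along
    [- a *: grad f y], and strong convexity at [y] compares [f y] with [f z].
    Adding the two inequalities makes [f y] disappear. Leaving [z] free gives
    both comparisons needed below: with the current iterate and with
    [xstar]. *)
Lemma gradient_step_decrease (R : realType) (p : nat) (m L a : R)
    (f : 'cV[R]_p -> R) (y z : 'cV[R]_p) :
  smooth L f -> strongly_convex m f ->
  f (y - a *: grad f y) - f z
  <= - \sum_i step_cost m L a ((y - z) i 0) (grad f y i 0).
Proof.
move=> fL [_ /(_ z y)]; have := descent y (- (a *: grad f y)) fL.
rewrite sum_step_cost -(opprB y z) !enormN enormZ exprMn.
rewrite real_normK ?num_real // !dotcvNr dotcvZr -enorm_sqr.
lra.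
Qed.

(** * The Lyapunov decrease *)

Lemma Atilde_Btilde_cv2 (R : realType) (alpha beta a b g : R) :
  Atilde beta *m cv2 a b + g *: Btilde alpha
  = cv2 ((1 + beta) * a - beta * b - alpha * g) a.
Proof.
apply/matrixP => -[[|[|//]] lti] j;
  by rewrite (ord1 j) !mxE !big_ord_recl big_ord0 !mxE /=; ring.
Qed.

Lemma lmi_stack (R : realType) (p : nat) (m L alpha beta rho : R) (Pt : 'M[R]_2)
    (a b g : 'cV[R]_p) :
  nsdmx (lmi_mx rho (Atilde beta) (Btilde alpha) Pt
         - Xtilde alpha beta m L rho) ->
  qform (Pt *t 1%:M) (stack ((1 + beta) *: a - beta *: b - alpha *: g) a)
  - rho ^+ 2 * qform (Pt *t 1%:M) (stack a b)
  <= rho ^+ 2 * (\sum_i step_cost m L alpha ((beta *: (a - b)) i 0) (g i 0))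
     + (1 - rho ^+ 2)
       * (\sum_i step_cost m L alpha
                   (((1 + beta) *: a - beta *: b) i 0) (g i 0)).
Proof.
move=> [_ lmi].
rewrite !qform_stack !mulr_sumr -sumrB -big_split /=; apply: ler_sum => i _.
have := lmi (col_mx (cv2 (a i 0) (b i 0)) (g i 0)%:M).
by rewrite qformB qform_lmi_mx Atilde_Btilde_cv2 qform_Xtilde subr_le0 !mxE.
Qed.

(** The two instances of [gradient_step_decrease] are weighted by [rho ^+ 2] and
    [1 - rho ^+ 2]; this is where [rho < 1] enters. *)
Lemma lyapunov_step (R : realType) (p : nat) (f : 'cV[R]_p -> R)
    (m L alpha beta rho : R) (Pt : 'M[R]_2) (xstar : 'cV[R]_p)
    (x : int -> 'cV[R]_p) (y : nat -> 'cV[R]_p) (k : nat) :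
  smooth L f -> strongly_convex m f -> nesterov f alpha beta x y ->
  0 <= rho -> rho < 1 ->
  nsdmx (lmi_mx rho (Atilde beta) (Btilde alpha) Pt
         - Xtilde alpha beta m L rho) ->
  lyapunov f (Pt *t 1%:M) xstar x k.+1
  <= rho ^+ 2 * lyapunov f (Pt *t 1%:M) xstar x k.
Proof.
move=> fL fm /(_ k)[yE xE] rho_ge0 rho_lt1 lmi.
have xkS : x k.+1%:Z = y k - alpha *: grad f (y k).
  by rewrite -xE; congr x; rewrite -addn1 PoszD.
have xk : k.+1%:Z - 1 = k%:Z by rewrite -addn1 PoszD addrK.
rewrite /lyapunov xk; set a := x k%:Z - xstar; set b := x (k%:Z - 1) - xstar.
set g := grad f (y k) in xkS *.
have yk_xk : y k - x k%:Z = beta *: (a - b).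
  by apply/matrixP => i j; rewrite yE !mxE; ring.
have yk_xs : y k - xstar = (1 + beta) *: a - beta *: b.
  by apply/matrixP => i j; rewrite yE !mxE; ring.
have xkS_xs : x k.+1%:Z - xstar = (1 + beta) *: a - beta *: b - alpha *: g.
  by rewrite xkS -yk_xs addrAC.
have := lmi_stack a b g lmi; rewrite -xkS_xs -yk_xk -yk_xs.
have := gradient_step_decrease alpha (y k) (x k%:Z) fL fm.
have := gradient_step_decrease alpha (y k) xstar fL fm.
have rho2 : 0 <= 1 - rho ^+ 2 by rewrite subr_ge0 expr_le1 // ltW.
rewrite -/g -xkS => /(ler_wpM2l rho2) fs /(ler_wpM2l (sqr_ge0 rho)) fk.
lra.
Qed.

Theorem theorem4 (R : realType) (p : nat) (f : 'cV[R]_p -> R) (m L : R)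
    (m_gt0 : 0 < m)
    (f_smooth : smooth L f)
    (f_convex : strongly_convex m f)
    (xstar : 'cV[R]_p) (grad_xstar : grad f xstar = 0)
    (alpha beta : R) (x : int -> 'cV[R]_p) (y : nat -> 'cV[R]_p)
    (x_nesterov : nesterov f alpha beta x y)
    (rho : R) (rho_ge0 : 0 <= rho) (rho_lt1 : rho < 1)
    (Pt : 'M[R]_2) (Pt_psd : psdmx Pt)
    (lmi : nsdmx (lmi_mx rho (Atilde beta) (Btilde alpha) Pt
                  - Xtilde alpha beta m L rho)) :
  let P : 'M[R]_(2 * p) := Pt *t 1%:M in
  (forall k : nat,
     lyapunov f P xstar x k.+1 <= rho ^+ 2 * lyapunov f P xstar x k) /\
  (forall k : nat,
     f (x k%:Z) - f xstar <= rho ^+ (2 * k) * lyapunov f P xstar x 0).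
Proof.
move=> P.
have V_step k : lyapunov f P xstar x k.+1 <= rho ^+ 2 * lyapunov f P xstar x k.
  exact: lyapunov_step f_smooth f_convex x_nesterov rho_ge0 rho_lt1 lmi.
split=> // k; apply: (@le_trans _ _ (lyapunov f P xstar x k)).
  rewrite /lyapunov lerDr qform_stack.
  by apply: sumr_ge0 => i _; have [_] := Pt_psd; apply.
elim: k => [|k IHk]; first by rewrite muln0 expr0 mul1r.
apply: le_trans (V_step k) _.
by rewrite mulnS exprD -mulrA ler_wpM2l // sqr_ge0.
Qed.
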